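(* Let $S$ be a semigroup of $I$-type with $I$-structure $v:\mathcal{U}\to S$. Let $S$ act on the right of $\mathcal{U}$ by pulling back under $v$ the action of $S$ on itself by right translation, i.e. $a\cdot s=v^{-1}(v(a)s)$ for $a\in\mathcal{U}$, $s\in S$. Identify $\mathcal{U}$ with $\mathbb{N}^n\subset\mathbb{R}^n$. Then this action extends to a free right action of $\bar S$ on $\mathbb{R}^n$ by Euclidean transformations, and for this action $[0,1[^n$ is a fundamental domain. In particular $\bar S$ is a Bieberbach group.
   Context: Semigroups have a unit. $\mathcal{U}$ is the free commutative multiplicative semigroup (with unit) generated by $u_1,\ldots,u_n$; it is identified with $\mathbb{N}^n$ via $u_1^{a_1}\cdots u_n^{a_n}\leftrightarrow(a_1,\ldots,a_n)$. A semigroup $S$ generated by $X=\{x_1,\ldots,x_n\}$ is of (left) $I$-type if there is a bijection $v:\mathcal{U}\to S$ (called an $I$-structure) such that $v(1)=1$ and, for all $a\in\mathcal{U}$, $\{v(u_1a),\ldots,v(u_na)\}=\{x_1v(a),\ldots,x_nv(a)\}$. Such an $S$ is cancellative and of subexponential growth, hence (left and right) Ore; $\bar S$ denotes its quotient group (group of fractions). Here $[0,1[\,=\{t\in\mathbb{R}\mid 0\le t<1\}$. Euclidean transformations are isometries of $\mathbb{R}^n$. A Bieberbach group is a torsion-free discrete cocompact group of isometries of $\mathbb{R}^n$. *)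

(* Defs.v *)
From HB Require Import structures.
From mathcomp Require Import all_boot all_order all_algebra.
From mathcomp Require Import all_classical all_reals all_analysis.

Set Implicit Arguments.
Unset Strict Implicit.
Unset Printing Implicit Defensive.

Import Order.TTheory GRing.Theory Num.Theory.
Import numFieldNormedType.Exports.

Local Open Scope classical_set_scope.
Local Open Scope ring_scope.

(* The free commutative semigroup on u_1, ..., u_n is 'rV[nat]_n, written
   additively: its unit is 0, its i-th generator is delta_mx 0 i, and the
   product u_i a is delta_mx 0 i + a. *)

Definition generated_by (S : monoidType) (n : nat) (x : 'I_n -> S) : Prop :=
  forall s : S, exists w : seq 'I_n, s = (\prod_(i <- w) x i)%g.

Definition I_structure (S : monoidType) (n : nat) (x : 'I_n -> S)
    (v : 'rV[nat]_n -> S) : Prop :=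
  [/\ bijective v,
      v 0 = 1%g &
      forall a : 'rV[nat]_n,
        range (fun i : 'I_n => v (delta_mx 0 i + a)) =
        range (fun i : 'I_n => (x i * v a)%g)].

Definition pullback_translation (S : monoidType) (n : nat)
    (v : 'rV[nat]_n -> S) (vinv : S -> 'rV[nat]_n)
    (a : 'rV[nat]_n) (s : S) : 'rV[nat]_n := vinv (v a * s)%g.

(* For a monoid satisfying the Ore conditions on both sides, its groups of left
   and of right fractions coincide, so asking for right fractions is enough. *)
Definition quotient_group (S : monoidType) (G : groupType) (iota : S -> G)
    : Prop :=
  [/\ monoid.monoid_morphism iota,
      injective iota &
      forall g : G, exists s t : S, g = (iota s / iota t)%g].

(* The library norm on 'rV[R]_n is the sup norm, hence the explicit Euclidean
   distance; both induce the library topology on 'rV[R]_n. *)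
Definition euclidean_dist (R : realType) (n : nat) (p q : 'rV[R]_n) : R :=
  Num.sqrt (\sum_(i < n) (p 0 i - q 0 i) ^+ 2).

Definition euclidean_isometry (R : realType) (n : nat) (f : 'rV[R]_n -> 'rV[R]_n)
    : Prop :=
  forall p q, euclidean_dist (f p) (f q) = euclidean_dist p q.

Record euclidean_action (R : realType) (n : nat) (G : groupType) :=
  EuclideanAction {
    eact :> 'rV[R]_n -> G -> 'rV[R]_n;
    eact1 : forall p, eact p 1%g = p;
    eactM : forall p g h, eact p (g * h)%g = eact (eact p g) h;
    eact_isometry : forall g, euclidean_isometry (eact^~ g)
  }.

Definition nat_point (R : realType) (n : nat) (a : 'rV[nat]_n) : 'rV[R]_n :=
  map_mx (fun k : nat => k%:R) a.

Definition half_open_cube (R : realType) (n : nat) : set 'rV[R]_n :=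
  [set p | forall i : 'I_n, 0 <= p 0 i < 1].

Section ActionProperties.
Context (R : realType) (n : nat) (G : groupType).
Variable A : euclidean_action R n G.

Definition free_action : Prop := forall p g, A p g = p -> g = 1%g.

Definition euclidean_orbit (p : 'rV[R]_n) : set 'rV[R]_n := range (A p).

Definition fundamental_domain (D : set 'rV[R]_n) : Prop :=
  forall p, exists! q, (euclidean_orbit p `&` D) q.

Definition same_orbit : rel 'rV[R]_n := fun p q => `[< euclidean_orbit p q >].

Lemma same_orbit_refl : reflexive same_orbit.
Proof. by move=> p; apply/asboolP; exists 1%g => //; exact: eact1. Qed.

Lemma same_orbit_sym : symmetric same_orbit.
Proof.
suff H p q : euclidean_orbit p q -> euclidean_orbit q p.
  by move=> p q; apply/asboolP/asboolP; exact: H.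
by move=> [g _ <-]; exists g^-1%g => //; rewrite -eactM mulgV eact1.
Qed.

Lemma same_orbit_trans : transitive same_orbit.
Proof.
move=> q p r /asboolP [g _ <-] /asboolP [h _ <-].
by apply/asboolP; exists (g * h)%g => //; rewrite eactM.
Qed.

Canonical same_orbit_equiv :=
  EquivRel same_orbit same_orbit_refl same_orbit_sym same_orbit_trans.

Definition orbit_space := quotient_topology {eq_quot same_orbit}%qT.

Definition cocompact : Prop := compact [set: orbit_space].

(* On isometries, the compact-open topology is the usual topology of the
   isometry group. *)
Definition discrete_action : Prop :=
  let Gamma : set {compact-open, 'rV[R]_n -> 'rV[R]_n} :=
    range (fun g : G => eact A ^~ g) in
  Gamma `<=` isolated Gamma.

Definition faithful_action : Prop := injective (fun g : G => eact A ^~ g).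

Definition torsion_free : Prop :=
  forall (g : G) (k : nat), (0 < k)%N -> (g ^+ k)%g = 1%g -> g = 1%g.

(* By faithfulness, G is a group of isometries of R^n. *)
Definition bieberbach : Prop :=
  [/\ faithful_action, torsion_free, discrete_action & cocompact].

End ActionProperties.

(* Main.v *)
Require Import Defs.
From HB Require Import structures.
From mathcomp Require Import all_boot all_order fingroup perm all_algebra.
From mathcomp Require Import all_classical all_reals all_analysis.

(** Writing [a . s] for the pulled back translation [v^-1 (v a * s)], the whole
    theorem rests on one rigidity fact: [a |-> a . s] permutes coordinates and
    translates.  The I-structure says that passing from [a] to a neighbour
    [u_i a] is the same as multiplying [v a] on the left by a generator, and
    left multiplication commutes with the right translation by [s]; so
    [(u_i a) . s = u_(t i) (a . s)] for a permutation [t] of the indices,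
    a priori depending on [a].  Going from [a] to [u_i u_k a] along both sides
    of a square forces [t] to be the same at [a] and at [u_k a], hence
    everywhere ([pullback_translation_affine]).

    Thus S maps into the group [motion n] of lattice motions
    [p |-> permutation of p + integer translation], and the quotient group G
    follows by the universal property of fractions ([fractions_extend]).
    These motions act compatibly on Z^n and R^n.  On Z^n the group G is simply
    transitive: the stabiliser of 0 is trivial because [0 . s = v^-1 s]
    determines [s], and every lattice point is in the orbit of 0 because
    [v (m, ..., m)] permutes coordinates and translates by [(m, ..., m)], which
    for large m brings any given point into N^n, the S-orbit of 0.

    The geometric claims follow from simple transitivity on Z^n alone.  Lattice
    motions commute with the coordinatewise floor, so the floor is an
    equivariant map from R^n to Z^n whose fibre over 0 is the half-open cube:
    this gives freeness and the fundamental domain.  An element of finite order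
    fixes the barycentre of an orbit, hence is trivial; the orbit of 0 lies in
    Z^n, hence the action is discrete; the compact cube [0,1]^n covers the
    orbit space, hence the action is cocompact. *)

Set Implicit Arguments.
Unset Strict Implicit.
Unset Printing Implicit Defensive.

Import Order.TTheory GRing.Theory Num.Theory.
Import numFieldNormedType.Exports.

Local Open Scope classical_set_scope.
Local Open Scope ring_scope.

(** * Groups of fractions *)

Lemma quotient_group_common_multiple (S : monoidType) (G : groupType)
    (iota : S -> G) :
  quotient_group iota -> forall s t : S, exists a b : S, (s * a = t * b)%g.
Proof.
move=> [[_ iotaM] iota_inj iotaP] s t.
have [a [b ab]] := iotaP ((iota s)^-1 * iota t)%g.
exists a, b; apply: iota_inj.
by rewrite !iotaM -[iota a](mulgVK (iota b)) -ab mulgA mulVKg.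
Qed.

(** A morphism from S to a group sends [s / t] to [rho s / rho t].  Common right
    multiples make this consistent: they put two fractions over the same
    denominator, and they rewrite the middle part [t^-1 s'] of a product
    [(s / t) (s' / t')] as a fraction. *)
Lemma fractions_extend (S : monoidType) (G : groupType) (iota : S -> G)
    (H : groupType) (rho : S -> H) :
  quotient_group iota -> monoid.monoid_morphism rho ->
  exists f : G -> H,
    monoid.monoid_morphism f /\ forall s, f (iota s) = rho s.
Proof.
move=> GS [rho1 rhoM]; have [[iota1 iotaM] iota_inj iotaP] := GS.
have well_defined s t s' t' : (iota s / iota t = iota s' / iota t')%g ->
    (rho s / rho t = rho s' / rho t')%g.
  move=> st; have [a [b ab]] := quotient_group_common_multiple GS t t'.
  have sab : (s * a = s' * b)%g.
    apply: iota_inj; rewrite !iotaM -[iota s](mulgVK (iota t)) st -!mulgA.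
    by rewrite -(iotaM t) ab iotaM mulKg.
  by rewrite -(mulgKA (rho a)) -!rhoM ab sab !rhoM mulgKA.
have /choice[f fP] g :
    exists h, forall s t, g = (iota s / iota t)%g -> h = (rho s / rho t)%g.
  have [s [t ->]] := iotaP g.
  by exists (rho s / rho t)%g => s' t' /well_defined.
have f_iota s : f (iota s) = rho s.
  by rewrite (fP _ s 1%g) ?rho1 ?divg1// iota1 divg1.
exists f; split=> //; split; first by rewrite -iota1 f_iota.
move=> g h; have [s [t gE]] := iotaP g; have [s' [t' hE]] := iotaP h.
have [a [b ab]] := quotient_group_common_multiple GS t s'.
have swap (K : groupType) (k : S -> K) : {morph k : y z / (y * z)%g} ->
    ((k s / k t) * (k s' / k t') = k (s * a)%g / k (t' * b)%g)%g.
  move=> kM; rewrite !kM invgM !mulgA; congr (_ * _)%g.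
  rewrite -!mulgA; congr (_ * _)%g; apply: (mulgI (k t)).
  by rewrite mulVKg mulgA -kM ab kM mulgK.
by rewrite (fP _ _ _ gE) (fP _ _ _ hE) swap//; apply: fP; rewrite gE hE swap.
Qed.

(** * Lattice motions *)

(** The pair [(s, c)] stands for the map [p |-> col_perm s p + c].  The product
    below composes from left to right, as suits a right action; since
    [col_perm (s * t)] is [col_perm s \o col_perm t], it multiplies the
    permutations in the opposite order. *)
Definition motion n : Type := 'S_n * 'rV[int]_n.

Section MotionGroup.
Context (n : nat).

HB.instance Definition _ := Choice.on (motion n).

Definition motion_mul (m k : motion n) : motion n :=
  ((k.1 * m.1)%g, col_perm k.1 m.2 + k.2).
Definition motion_one : motion n := (1%g, 0).
Definition motion_inv (m : motion n) : motion n :=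
  ((m.1)^-1%g, - col_perm (m.1)^-1%g m.2).

Lemma col_permD (V : nmodType) (s : 'S_n) (p q : 'rV[V]_n) :
  col_perm s (p + q) = col_perm s p + col_perm s q.
Proof. by apply/rowP => i; rewrite !mxE. Qed.

Lemma motion_mulA : associative motion_mul.
Proof.
move=> a b c; congr pair; first by rewrite /= mulgA.
by rewrite /= col_permD col_permM addrA.
Qed.

Lemma motion_mul1 : left_id motion_one motion_mul.
Proof.
move=> [s c]; congr pair; first by rewrite /= mulg1.
by apply/rowP => i; rewrite !mxE add0r.
Qed.

Lemma motion_mulr1 : right_id motion_one motion_mul.
Proof. by move=> [s c]; congr pair; rewrite /= ?mul1g// col_perm1 addr0. Qed.

Lemma motion_mulV : left_inverse motion_one motion_inv motion_mul.
Proof.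
move=> [s c]; congr pair; first by rewrite /= mulgV.
by apply/rowP => i; rewrite !mxE permK addNr.
Qed.

Lemma motion_mulrV : right_inverse motion_one motion_inv motion_mul.
Proof. by move=> [s c]; congr pair; rewrite /= ?mulVg// subrr. Qed.

HB.instance Definition _ := isGroup.Build (motion n)
  motion_mulA motion_mul1 motion_mulr1 motion_mulV motion_mulrV.

(** Taking any ring of coordinates lets the same formula act on Z^n, where the
    group is analysed, and on R^n, where the theorem lives. *)
Definition motion_act (E : pzRingType) (m : motion n) (p : 'rV[E]_n) :=
  col_perm m.1 p + map_mx intr m.2.

Lemma motion_act1 (E : pzRingType) (p : 'rV[E]_n) : motion_act 1%g p = p.
Proof. by rewrite /motion_act col_perm1; apply/rowP => i; rewrite !mxE addr0. Qed.

Lemma motion_actM (E : pzRingType) (m k : motion n) (p : 'rV[E]_n) :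
  motion_act (m * k)%g p = motion_act k (motion_act m p).
Proof. by apply/rowP => i; rewrite !mxE permM rmorphD addrA. Qed.

Lemma motion_act_intr (E : pzRingType) (m : motion n) (z : 'rV[int]_n) :
  motion_act m (map_mx intr z) = map_mx intr (motion_act m z) :> 'rV[E]_n.
Proof. by apply/rowP => i; rewrite !mxE rmorphD intz. Qed.

(** Floors are compatible with integer translations and act coordinatewise, so
    R^n maps equivariantly onto Z^n; questions about orbits in R^n reduce to
    orbits in Z^n through this map. *)
Lemma motion_act_floor (R : realType) (m : motion n) (p : 'rV[R]_n) :
  map_mx Num.floor (motion_act m p) = motion_act m (map_mx Num.floor p).
Proof.
by apply/rowP => i; rewrite !mxE floorDrz ?intr_int// intrKfloor intz.
Qed.

Lemma motion_act_isometry (R : realType) (m : motion n) :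
  euclidean_isometry (motion_act m : 'rV[R]_n -> 'rV[R]_n).
Proof.
move=> p q; congr Num.sqrt; rewrite [RHS](reindex_inj (@perm_inj _ m.1)) /=.
by apply: eq_bigr => i _; rewrite !mxE opprD addrACA subrr addr0.
Qed.

(** An affine map preserves barycentres.  It will be applied to the orbit of a
    point under an element of finite order. *)
Lemma motion_act_mean (R : realType) (m : motion n) k (p : nat -> 'rV[R]_n) :
  (0 < k)%N ->
  motion_act m (k%:R^-1 *: \sum_(i < k) p i) =
  k%:R^-1 *: \sum_(i < k) motion_act m (p i).
Proof.
move=> k0; apply/rowP => j; rewrite !mxE !summxE.
under [in RHS]eq_bigr do rewrite !mxE.
rewrite big_split sumr_const card_ord mulrDr -[X in _ = _ + _ * X]mulr_natl.
by rewrite mulKf// pnatr_eq0 -lt0n.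
Qed.

(** The value at 0 gives the translation part; the permutation is then read off
    at a point with distinct coordinates.  Identities between the motions
    attached to elements of S can thus be checked on N^n. *)
Lemma motion_natP (m k : motion n) :
  (forall a : 'rV[nat]_n,
     motion_act m (map_mx Posz a) = motion_act k (map_mx Posz a)) ->
  m = k.
Proof.
case: m k => [s c] [t d] mk.
have cd : c = d.
  by apply/rowP => i; have /rowP/(_ i) := mk 0; rewrite !mxE !add0r !intz.
congr pair => //; apply/permP => i.
(* The coordinates of (0, 1, ..., n - 1) are pairwise distinct. *)
have /rowP/(_ i) := mk (\row_j (j : nat)).
by rewrite !mxE cd => /addIr[] /ord_inj.
Qed.

End MotionGroup.

(** * Groups of lattice motions simply transitive on the lattice *)

Section SimplyTransitive.
Context (R : realType) (n : nat) (G : groupType) (f : G -> motion n).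
Context (f1 : f 1%g = 1%g) (fM : {morph f : g h / (g * h)%g}).
Context (f_free : forall g (z : 'rV[int]_n), motion_act (f g) z = z -> g = 1%g).
Context (f_trans : forall z : 'rV[int]_n, exists g, motion_act (f g) z = 0).

Fact motion_eact1 (p : 'rV[R]_n) : motion_act (f 1%g) p = p.
Proof. by rewrite f1 motion_act1. Qed.

Fact motion_eactM (p : 'rV[R]_n) g h :
  motion_act (f (g * h)%g) p = motion_act (f h) (motion_act (f g) p).
Proof. by rewrite fM motion_actM. Qed.

Definition motion_eact : euclidean_action R n G :=
  EuclideanAction motion_eact1 motion_eactM
    (fun g => motion_act_isometry (f g)).

Lemma motion_eact_free : free_action motion_eact.
Proof.
move=> p g /(congr1 (map_mx Num.floor)).
by rewrite /= motion_act_floor => /f_free.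
Qed.

(** The half-open cube is the fibre of the floor map over the origin, which is
    why a simply transitive action on Z^n has it as fundamental domain. *)
Lemma half_open_cubeP (p : 'rV[R]_n) :
  half_open_cube p <-> map_mx Num.floor p = 0.
Proof.
split=> [p01|/rowP p0 i].
  by apply/rowP => i; rewrite !mxE; apply: floor_def; rewrite add0r p01.
by have := floor_itv (p 0 i); have := p0 i; rewrite !mxE => ->; rewrite add0r.
Qed.

Lemma motion_eact_fundamental_domain :
  fundamental_domain motion_eact (@half_open_cube R n).
Proof.
move=> p; have [g gp] := f_trans (map_mx Num.floor p).
exists (motion_eact p g); split.
  by split; [exists g | apply/half_open_cubeP; rewrite motion_act_floor].
move=> _ [[h _ <-] /half_open_cubeP].
rewrite motion_act_floor -gp => /(congr1 (motion_act (f g^-1%g))).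
by rewrite -!motion_actM -!fM mulgV f1 motion_act1 => /f_free /divg1_eq ->.
Qed.

Lemma motion_eact_faithful : faithful_action motion_eact.
Proof.
move=> g h /(congr1 (@^~ 0)) gh; apply: divg1_eq.
apply: (@motion_eact_free 0).
by rewrite eactM gh -eactM mulgV eact1.
Qed.

(** If [g ^+ k = 1], the barycentre of [0, 0 . g, ..., 0 . g ^+ (k - 1)] is fixed
    by [g], and the action is free. *)
Lemma motion_eact_torsion_free : torsion_free G.
Proof.
move=> g k k0 gk1; pose orb i := motion_eact (0 : 'rV[R]_n) (g ^+ i)%g.
apply: (@motion_eact_free (k%:R^-1 *: \sum_(i < k) orb i)).
have orbS i : orb i.+1 = motion_act (f g) (orb i).
  by rewrite /orb expgSr eactM.
have sum_orbS : \sum_(i < k) orb i.+1 = \sum_(i < k) orb i.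
  case: k k0 gk1 @orb orbS => // k _ gk1 orb orbS.
  by rewrite big_ord_recr [RHS]big_ord_recl addrC /orb gk1 expg0.
rewrite -[in RHS]sum_orbS; under [in RHS]eq_bigr do rewrite orbS.
exact: motion_act_mean.
Qed.

(** The orbit of 0 consists of lattice points, so two elements moving 0 to points
    less than 1 apart agree at 0, hence are equal. *)
Lemma motion_eact_discrete : discrete_action motion_eact.
Proof.
move=> _ [g _ <-]; split; first by apply/mem_set; exists g.
pose p := motion_eact (0 : 'rV[R]_n) g.
(* A subbasic neighbourhood of the compact-open topology, for the compact
   set {0} and the open unit ball (of the sup norm) around its image. *)
exists [set k | k @` [set (0 : 'rV[R]_n)] `<=` ball p 1].
  apply: open_nbhs_nbhs; split.
    by apply: compact_open_open; [exact: compact_set1 | exact: ball_open].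
  by move=> _ [_ -> <-]; exact: ballxx.
apply/seteqP; split=> [k [gB [h _ hk]]|_ ->]; last first.
  by split; [move=> _ [_ -> <-]; exact: ballxx | exists g].
rewrite -{k}hk in gB *; have hB : ball p 1 (motion_eact 0 h).
  by apply: gB; exists 0.
suff -> : h = g by [].
apply/divg1_eq/(f_free (z := 0)).
suff hg : motion_act (f h) (0 : 'rV[int]_n) = motion_act (f g) 0.
  by rewrite fM motion_actM hg -motion_actM -fM mulgV f1 motion_act1.
apply/rowP => i; have := hB.2 0 i; rewrite !mxE !add0r !intz /ball /=.
rewrite -rmorphB -intr_norm -[1]/(1%:~R) ltr_int -abszE ltz_nat ltnS leqn0.
by rewrite absz_eq0 subr_eq0 => /eqP.
Qed.

(** The orbit space is the continuous image of the closed unit cube, which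
    contains the fundamental domain. *)
Lemma motion_eact_cocompact : cocompact motion_eact.
Proof.
pose cube : set 'rV[R]_n :=
  [set p : 'rV[R]_n | forall i, `[0, 1]%classic (p 0 i)].
have cubeC : compact cube.
  have := @rV_compact R n (fun=> `[0, 1]%classic).
  by apply => i; exact: segment_compact.
pose pi := \pi_(orbit_space motion_eact)%qT : 'rV[R]_n -> _.
rewrite /cocompact (_ : [set: _] = pi @` cube).
  apply: continuous_compact => //; apply: continuous_subspaceT.
  exact: pi_continuous.
apply/seteqP; split=> // q _.
have [p [[orb_p p01] _]] :=
  motion_eact_fundamental_domain (generic_quotient.repr q).
exists p; first by move=> i; have /andP[p0 /ltW p1] := p01 i; rewrite /= in_itv /= p0.
rewrite -[RHS]reprK; apply/esym/eqquotP; exact/asboolP.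
Qed.

Lemma motion_eact_bieberbach : bieberbach motion_eact.
Proof.
split; [exact: motion_eact_faithful | exact: motion_eact_torsion_free |
  exact: motion_eact_discrete | exact: motion_eact_cocompact].
Qed.

End SimplyTransitive.

(** * Semigroups of I-type *)

Section RowNat.
Context (n : nat).
Implicit Types (i : 'I_n) (a : 'rV[nat]_n).

Local Notation e i := (delta_mx 0 i : 'rV[nat]_n).

Lemma row_nat_ind (P : 'rV[nat]_n -> Prop) :
  P 0 -> (forall i a, P a -> P (e i + a)) -> forall a, P a.
Proof.
move=> P0 PS a; have [m] := ubnP (\sum_i a 0%R i)%N.
elim: m a => // m IHm a; rewrite ltnS => am.
have [a0|/forallPn[i ai]] := boolP [forall i, a 0 i == 0%N].
  by rewrite (_ : a = 0) //; apply/rowP => i; rewrite mxE; apply/eqP/(forallP a0).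
pose b : 'rV[nat]_n := \row_j (a 0%R j - (j == i))%N.
have ab : a = e i + b.
  apply/rowP => j; rewrite !mxE eqxx /=; have [->|_] := eqVneq j i.
    by rewrite -[RHS]/(1 + (a 0%R i - 1))%N subnKC// lt0n.
  by rewrite add0r subn0.
rewrite ab; apply/PS/IHm/(leq_trans _ am).
rewrite ab (bigD1 i)//= [ltnRHS](bigD1 i)//= !mxE !eqxx.
rewrite -addSn leq_add//; apply: leq_sum => j _.
by rewrite !mxE leq_addl.
Qed.

Lemma row_nat_addIr (a : 'rV[nat]_n) : injective (+%R^~ a).
Proof.
by move=> b c /rowP bc; apply/rowP => i; have := bc i; rewrite !mxE => /addIn.
Qed.

Lemma row_nat_delta_inj : injective (fun i => e i).
Proof. by move=> i j /rowP/(_ i); rewrite !mxE !eqxx /=; case: eqP. Qed.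

End RowNat.

Section IStructure.
Context (n : nat) (S : monoidType) (x : 'I_n -> S).
Context (v : 'rV[nat]_n -> S) (vinv : S -> 'rV[nat]_n).
Context (vI : I_structure x v) (vK : cancel v vinv) (vinvK : cancel vinv v).

Local Notation e i := (delta_mx 0 i : 'rV[nat]_n).

(** The two n-element sets of an I-structure are matched by a map of indices,
    injective because v is. *)
Lemma I_structure_perm (a : 'rV[nat]_n) :
  exists s : 'S_n, forall i, v (e i + a) = (x (s i) * v a)%g.
Proof.
have [_ _ /(_ a) /seteqP[sub _]] := vI.
have /choice[s sP] i : exists j, v (e i + a) = (x j * v a)%g.
  by have [j _ <-] := sub _ (imageT _ i); exists j.
have s_inj : injective s.
  move=> i j sij; apply/row_nat_delta_inj/(row_nat_addIr (a := a))/(can_inj vK).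
  by rewrite !sP sij.
by exists (perm s_inj) => i; rewrite permE.
Qed.

(** Left multiplication by a generator commutes with right translation by [s], and
    by [I_structure_perm] it amounts to a unit step in N^n, both at [a] and at
    the image of [a]. *)
Lemma pullback_translation_generator (a : 'rV[nat]_n) (s : S) :
  exists t : 'S_n, forall i,
    pullback_translation v vinv (e i + a) s =
    e (t i) + pullback_translation v vinv a s.
Proof.
have [p pP] := I_structure_perm a.
have [q qP] := I_structure_perm (pullback_translation v vinv a s).
exists (p * q^-1)%g => i; apply: (can_inj vK).
by rewrite /pullback_translation in qP *; rewrite qP !vinvK pP permM permKV mulgA.
Qed.

(** The permutation [t a] of the previous lemma does not depend on [a].  The two
    ways from [a] to [u_i u_k a], for [i] and [k] distinct, give
    [u_(t (u_k a) i) u_(t a k) = u_(t (u_i a) k) u_(t a i)]; as [t a i] and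
    [t a k] differ, [t (u_k a) i = t a i].  So [t (u_k a)] and [t a] agree
    except possibly at [k], and two permutations cannot differ at a single
    point. *)
Lemma pullback_translation_affine (s : S) :
  exists t : 'S_n, forall a,
    pullback_translation v vinv a s = col_perm t a + vinv s.
Proof.
set phi := (pullback_translation v vinv)^~ s.
have /choice[t tP] a : exists t : 'S_n, forall i,
    phi (e i + a) = e (t i) + phi a by exact: pullback_translation_generator.
have off_diag a i k : k != i -> t (e k + a) i = t a i.
  move=> ki; have : phi (e i + (e k + a)) = phi (e k + (e i + a)).
    by rewrite addrCA.
  (* Compare the exponents of the generator of index t a i. *)
  rewrite !tP => /rowP/(_ (t a i)); rewrite !mxE !eqxx /=.
  rewrite !(inj_eq perm_inj) [i == k]eq_sym (negbTE ki) add0r addrA => /addIn.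
  by case: (t a i =P _) => // _; case: (_ == _).
have t_step a k : t (e k + a) = t a.
  apply/permP => i; have [<-|/off_diag//] := eqVneq k i.
  pose j := ((t (e k + a))^-1)%g (t a k).
  have tj : t (e k + a) j = t a k by rewrite permKV.
  have [kj|kj] := eqVneq k j; first by rewrite {2}kj.
  by move: tj; rewrite off_diag// => /perm_inj jk; rewrite jk eqxx in kj.
have t_const a : t a = t 0 by elim/row_nat_ind: a => // i a <-.
(* col_perm s moves the coordinate of index s j to index j, hence the inverse. *)
exists ((t 0)^-1)%g; elim/row_nat_ind => [|i a IHa].
  have [_ v0 _] := vI.
  rewrite /pullback_translation v0 mul1g.
  by apply/rowP => i; rewrite !mxE add0r.
rewrite -/(phi _) tP t_const [phi a]IHa col_permD addrA; congr (_ + _ + _).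
by apply/rowP => j; rewrite !mxE eqxx -(inj_eq (@perm_inj _ (t 0)) _ i) permKV.
Qed.

Lemma pullback_translation_motion :
  exists rho : S -> motion n, monoid.monoid_morphism rho /\
    forall s (a : 'rV[nat]_n), motion_act (rho s) (map_mx Posz a) =
      map_mx Posz (pullback_translation v vinv a s).
Proof.
have /choice[t tP] := pullback_translation_affine.
pose rho s : motion n := (t s, map_mx Posz (vinv s)).
have rhoP s (a : 'rV[nat]_n) : motion_act (rho s) (map_mx Posz a) =
    map_mx Posz (pullback_translation v vinv a s).
  by rewrite tP; apply/rowP => i; rewrite !mxE intz.
exists rho; split=> //; split=> [|s s']; apply: motion_natP => a.
  by rewrite rhoP motion_act1 /pullback_translation mulg1 vK.
by rewrite motion_actM !rhoP /pullback_translation vinvK mulgA.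
Qed.

Context (G : groupType) (iota : S -> G) (GS : quotient_group iota).
Context (f : G -> motion n) (f1 : f 1%g = 1%g).
Context (fM : {morph f : g h / (g * h)%g}).
Context (fP : forall s (a : 'rV[nat]_n),
  motion_act (f (iota s)) (map_mx Posz a) =
  map_mx Posz (pullback_translation v vinv a s)).

Lemma motion_act_fK g : cancel (@motion_act n int (f g)) (motion_act (f g^-1%g)).
Proof. by move=> z; rewrite -motion_actM -fM mulgV f1 motion_act1. Qed.

Lemma fraction_origin s : motion_act (f (iota s)) 0 = map_mx Posz (vinv s).
Proof.
have [_ v0 _] := vI.
have <- : map_mx Posz (0 : 'rV[nat]_n) = 0 by apply/rowP => i; rewrite !mxE.
by rewrite fP /pullback_translation v0 mul1g.
Qed.

(** For [g = s / t], the hypothesis says [0 . s = 0 . t], that is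
    [v^-1 s = v^-1 t]. *)
Lemma fraction_free0 g : motion_act (f g) (0 : 'rV[int]_n) = 0 -> g = 1%g.
Proof.
have [_ iota_inj /(_ g)[s [t ->]]] := GS.
move=> /(congr1 (motion_act (f (iota t)))).
rewrite -motion_actM -fM mulgVK !fraction_origin => st.
suff -> : s = t by rewrite mulgV.
apply: (can_inj vinvK); apply/rowP => i.
by have /rowP/(_ i) := st; rewrite !mxE => -[].
Qed.

(** The motion of [v (m, ..., m)] is a permutation of coordinates followed by the
    translation by [(m, ..., m)].  With m at least every [|z_i|] it sends [z] to
    some [a] in N^n, and [v a] sends 0 to that same [a]. *)
Lemma fraction_transitive (z : 'rV[int]_n) : exists g, motion_act (f g) z = 0.
Proof.
(* Any upper bound of the |z_i| would do; their sum is the simplest. *)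
pose m := \sum_i `|z 0%R i|%N.
pose t := v (const_mx m).
have [a aP] : exists a : 'rV[nat]_n,
    motion_act (f (iota t)) z = map_mx Posz a.
  exists (map_mx absz (motion_act (f (iota t)) z)).
  apply/rowP => i; rewrite !mxE intz gez0_abs//.
  have /rowP/(_ i) := fraction_origin t; rewrite vK !mxE add0r intz => ->.
  rewrite -lerBlDr sub0r; apply: lerNnormlW.
  by rewrite -abszE lez_nat /m (bigD1 ((f (iota t)).1 i)) //= leq_addr.
exists (iota t / iota (v a))%g.
by rewrite fM motion_actM aP -[X in map_mx _ X]vK -fraction_origin motion_act_fK.
Qed.

(** Point stabilisers are conjugate along the single orbit. *)
Lemma fraction_free g (z : 'rV[int]_n) : motion_act (f g) z = z -> g = 1%g.
Proof.
have [h hz] := fraction_transitive z.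
have z0 : z = motion_act (f h^-1%g) 0 by rewrite -hz motion_act_fK.
rewrite {1}z0 => gz; suff : (h^-1 * g * h = 1)%g.
  move=> /(congr1 (fun k => h * k / h)%g).
  by rewrite !mulgA mulgV mul1g mulg1 mulgK mulgV.
by apply: fraction_free0; rewrite !fM !motion_actM gz.
Qed.

End IStructure.

Theorem theorem1p7 (R : realType) (n : nat) (S : monoidType) (x : 'I_n -> S)
    (v : 'rV[nat]_n -> S) (vinv : S -> 'rV[nat]_n)
    (Sgen : generated_by x) (vI : I_structure x v)
    (vK : cancel v vinv) (vinvK : cancel vinv v)
    (G : groupType) (iota : S -> G) (GS : quotient_group iota) :
  exists A : euclidean_action R n G,
    [/\ forall (a : 'rV[nat]_n) (s : S),
          A (nat_point R a) (iota s) =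
          nat_point R (pullback_translation v vinv a s),
        free_action A,
        fundamental_domain A (@half_open_cube R n) &
        bieberbach A].
Proof.
have [rho [rhoM rhoP]] := pullback_translation_motion vI vK vinvK.
have [f [[f1 fM] f_iota]] := fractions_extend GS rhoM.
have fP s (a : 'rV[nat]_n) : motion_act (f (iota s)) (map_mx Posz a) =
    map_mx Posz (pullback_translation v vinv a s) by rewrite f_iota.
have f_free := fraction_free vI vK vinvK GS f1 fM fP.
have f_trans := fraction_transitive vI vK f1 fM fP.
exists (motion_eact R f1 fM); split.
- have natE (b : 'rV[nat]_n) : nat_point R b = map_mx intr (map_mx Posz b).
    by apply/rowP => i; rewrite !mxE.
  by move=> a s; rewrite !natE -fP -motion_act_intr.
- exact: motion_eact_free.
- exact: motion_eact_fundamental_domain.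
- exact: motion_eact_bieberbach.
Qed.
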